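(* Let $(\mathfrak g_0,B_0,(\rho,V))$ be a fundamental triplet over $\mathbb C$ such that $\mathfrak g_0=Z(\mathfrak g_0)\oplus\mathfrak g_0'$ is reductive with one-dimensional center $Z(\mathfrak g_0)$, where $\mathfrak g_0'=[\mathfrak g_0,\mathfrak g_0]$, and such that $\rho(Z(\mathfrak g_0))=\mathbb C\,\mathrm{Id}_V$. Then the local Lie algebra $\Gamma(\mathfrak g_0,B_0,\rho)$ is associated to an $\mathfrak{sl}_2$-triple if and only if there exists $X\in V$ such that $X\notin\mathfrak g_0'.X$, where $\mathfrak g_0'.X=\{\rho(U)X\mid U\in\mathfrak g_0'\}$. Moreover the set $\{X\in V\mid X\notin\mathfrak g_0'.X\}$ is exactly the set of elements of $V$ which belong to an associated $\mathfrak{sl}_2$-triple.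
   Context: All vector spaces and Lie algebras are over $\mathbb C$. A fundamental triplet $(\mathfrak g_0,B_0,(\rho,V))$ consists of a finite-dimensional Lie algebra $\mathfrak g_0$, a non-degenerate invariant symmetric bilinear form $B_0$ on $\mathfrak g_0$, and a finite-dimensional representation $(\rho,V)$ of $\mathfrak g_0$; $(\rho^*,V^* )$ is the contragredient representation. $\Gamma(\mathfrak g_0,B_0,\rho)=V^*\oplus\mathfrak g_0\oplus V$ (degrees $-1,0,1$) carries the partial anticommutative bracket given by the bracket of $\mathfrak g_0$, $[U,X]=\rho(U)X$, $[U,Y]=\rho^*(U)Y$, and $[X,Y]\in\mathfrak g_0$ defined by $B_0([X,Y],U)=Y(\rho(U)X)$ for all $U\in\mathfrak g_0$ ($X\in V$, $Y\in V^*$); it is a local Lie algebra (the Jacobi identity holds whenever its three terms are defined). Under the assumptions of the claim there is an element $H_0\in Z(\mathfrak g_0)$ such that $\rho(H_0)=2\,\mathrm{Id}_V$ (and $\rho^*(H_0)=-2\,\mathrm{Id}_{V^*}$). A triple $(y,h,x)$ in a local Lie algebra is an $\mathfrak{sl}_2$-triple if $[h,x]=2x$, $[h,y]=-2y$, $[y,x]=h$. The local Lie algebra $\Gamma(\mathfrak g_0,B_0,\rho)$ is said to be associated to an $\mathfrak{sl}_2$-triple if there exist $X\in V$ and $Y\in V^*$ such that $(Y,H_0,X)$ is an $\mathfrak{sl}_2$-triple; such a triple $(Y,H_0,X)$ is called an associated $\mathfrak{sl}_2$-triple. *)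

(* Defs.v *)
From HB Require Import structures.
From mathcomp Require Import all_boot all_order all_algebra.
From mathcomp Require Import classical_sets reals complex.

Set Implicit Arguments.
Unset Strict Implicit.
Unset Printing Implicit Defensive.

Import GRing.Theory.
Local Open Scope ring_scope.

Section BilinearMaps.
Variables (F : fieldType) (U V W : vectType F) (f : U -> V -> W).
Definition linfun2 : 'Hom(U, 'Hom(V, W)) := linfun (fun u => linfun (f u)).

Lemma linfun2E u v :
  (forall v', linear (f^~ v')) -> (forall u', linear (f u')) ->
  linfun2 u v = f u v.
Proof.
move=> f_linl f_linr.
have frE u' : linfun (f u') =1 f u'.
  pose g : {linear V -> W} :=
    HB.pack (f u') (GRing.isLinear.Build _ _ _ _ (f u') (f_linr u')).
  exact: (lfunE g).
have h_lin : linear (fun u' => linfun (f u')).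
  move=> a u1 u2; apply/lfunP => w.
  by rewrite add_lfunE scale_lfunE !frE f_linl.
pose h : {linear U -> 'Hom(V, W)} :=
  HB.pack (fun u' => linfun (f u')) (GRing.isLinear.Build _ _ _ _ _ h_lin).
by rewrite /linfun2 (lfunE h u) frE.
Qed.
End BilinearMaps.

(* Finite-dimensionality is part of the structure, through vectType. *)
HB.mixin Record Vector_isLieAlgebra (F : fieldType) L of Vector F L := {
  lie : L -> L -> L;
  lie_linearl : forall y, linear (lie^~ y);
  lie_linearr : forall x, linear (lie x);
  liexx : forall x, lie x x = 0;
  lie_jacobi : forall x y z,
    lie x (lie y z) + lie y (lie z x) + lie z (lie x y) = 0
}.

#[short(type="lieAlgType")]
HB.structure Definition LieAlgebra (F : fieldType) :=
  { L of Vector_isLieAlgebra F L & Vector F L }.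

Section LieAlgebraTheory.
Variables (F : fieldType) (g : lieAlgType F).
Implicit Types (x y z : g) (I J W : {vspace g}).

Definition ad : 'Hom(g, 'End(g)) := linfun2 (@lie F g).

Lemma adE x y : ad x y = lie x y.
Proof. exact: linfun2E (@lie_linearl F g) (@lie_linearr F g). Qed.

Lemma lieC x y : lie x y = - lie y x.
Proof.
apply/eqP; rewrite -addr_eq0 -!adE.
have := @liexx F g (x + y).
by rewrite -!adE !linearD /= !add_lfunE !adE !liexx add0r addr0 -!adE addrC =>->.
Qed.

Definition lie_center : {vspace g} := lker ad.

Lemma lie_centerP x : reflect (forall y, lie x y = 0) (x \in lie_center).
Proof.
rewrite memv_ker; apply: (iffP eqP) => [adx0 y|x0].
  by rewrite -adE adx0 zero_lfunE.
by apply/lfunP => y; rewrite adE x0 zero_lfunE.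
Qed.

Definition lie_derived : {vspace g} :=
  <<[seq lie x y | x <- vbasis fullv, y <- vbasis fullv]>>%VS.

Lemma lie_derivedP W :
  reflect (forall x y, lie x y \in W) (lie_derived <= W)%VS.
Proof.
apply: (iffP span_subvP) => [sW x y|sW _ /allpairsP[[x y] /= [_ _ ->]]] //.
have sW' u v : u \in vbasis fullv -> v \in vbasis fullv -> lie u v \in W.
  by move=> ? ?; apply: sW; apply: allpairs_f.
have adW u : u \in vbasis fullv -> (ad u @: fullv <= W)%VS.
  move=> uB; rewrite -(span_basis (vbasisP fullv)) limg_span.
  by apply/span_subvP => _ /mapP[v vB ->]; rewrite adE sW'.
have: (limg (ad y) <= W)%VS.
  apply/subvP => _ /memv_imgP[v _ ->].
  rewrite (coord_vbasis (memvf v)) linear_sum memv_suml // => i _.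
  rewrite linearZ memvZ //= adE lieC memvN -adE.
  apply: (subvP (adW _ _)); last exact/memv_img/memvf.
  by apply: mem_nth; rewrite size_tuple.
by rewrite lieC memvN -adE => /subvP; apply; apply/memv_img/memvf.
Qed.

Definition lie_ideal I := forall x y, y \in I -> lie x y \in I.

(* The adjoint representation is semisimple: every ideal is a direct summand.
   In particular g is the direct sum of its center and its derived algebra. *)
Definition reductive :=
  forall I, lie_ideal I ->
    exists J, [/\ lie_ideal J, (I + J)%VS = fullv & (I :&: J)%VS = 0%VS].

Lemma reductive_decomposition : reductive ->
  (lie_center + lie_derived)%VS = fullv /\
  (lie_center :&: lie_derived)%VS = 0%VS.
Proof.
have mem_der x y : lie x y \in lie_derived.
  by have/lie_derivedP := subvv lie_derived; apply.
move=> red; split.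
  have [|J [Jid gE capE]] := red lie_derived; first by move=> x y _.
  apply/eqP; rewrite eqEsubv subvf -gE addvC addvS //=; apply/subvP => x xJ.
  apply/lie_centerP => y; apply/eqP; rewrite -memv0 -capE memv_cap mem_der.
  by rewrite lieC memvN Jid.
have [|K [Kid gE capE]] := red lie_center.
  by move=> x y /lie_centerP yZ; rewrite lieC yZ oppr0 mem0v.
suff sK : (lie_derived <= K)%VS.
  by apply/eqP; rewrite -subv0 -capE capvS.
apply/lie_derivedP => x y.
have: x \in (lie_center + K)%VS by rewrite gE memvf.
case/memv_addP => z /lie_centerP zZ [k kK ->].
by rewrite -adE linearD add_lfunE /= !adE zZ add0r lieC memvN Kid.
Qed.
End LieAlgebraTheory.

(* A local Lie algebra L_{-1} + L_0 + L_1.  Only the brackets [L_0, L_1],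
   [L_0, L_{-1}] and [L_1, L_{-1}] are recorded, the opposite ones being
   determined by anticommutativity; the fields ll_jacobi* are, together with
   the Jacobi identity of L_0, all the instances in which the three terms of
   the Jacobi identity are defined. *)
Record local_lie_algebra (F : fieldType) := LocalLieAlgebra {
  ll_zero : lieAlgType F;
  ll_pos : vectType F;
  ll_neg : vectType F;
  ll_actp : 'Hom(ll_zero, 'End(ll_pos));
  ll_actn : 'Hom(ll_zero, 'End(ll_neg));
  ll_pair : 'Hom(ll_pos, 'Hom(ll_neg, ll_zero));
  ll_jacobi00p : forall u v x,
    ll_actp (lie u v) x = ll_actp u (ll_actp v x) - ll_actp v (ll_actp u x);
  ll_jacobi00n : forall u v y,
    ll_actn (lie u v) y = ll_actn u (ll_actn v y) - ll_actn v (ll_actn u y);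
  ll_jacobi0pn : forall u x y,
    lie u (ll_pair x y) = ll_pair (ll_actp u x) y + ll_pair x (ll_actn u y)
}.

(* The condition [y, x] = h is written with [y, x] = - [x, y]. *)
Definition sl2_triple (F : fieldType) (L : local_lie_algebra F)
    (y : ll_neg L) (h : ll_zero L) (x : ll_pos L) :=
  [/\ ll_actp L h x = 2%:R *: x,
      ll_actn L h y = - (2%:R *: y) &
      - ll_pair L x y = h].

Record fundamental_triplet (F : fieldType) := FundamentalTriplet {
  ft_lie : lieAlgType F;
  ft_space : vectType F;
  ft_form : 'Hom(ft_lie, 'Hom(ft_lie, F^o));
  ft_rep : 'Hom(ft_lie, 'End(ft_space));
  ft_formC : forall u v, ft_form u v = ft_form v u;
  ft_form_invariant : forall u v w,
    ft_form (lie u v) w = ft_form u (lie v w);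
  ft_form_nondegenerate : forall u, (forall v, ft_form u v = 0) -> u = 0;
  ft_repP : forall u v, ft_rep (lie u v) =
    (ft_rep u \o ft_rep v)%VF - (ft_rep v \o ft_rep u)%VF
}.

Section Gamma.
Variables (F : fieldType) (T : fundamental_triplet F).
Local Notation g := (ft_lie T).
Local Notation V := (ft_space T).
Local Notation V' := 'Hom(V, F^o).
Local Notation B := (ft_form T).
Local Notation rho := (ft_rep T).

Definition contragredient : 'Hom(g, 'End(V')) :=
  linfun2 (fun (u : g) (y : V') => - (y \o rho u)%VF : V').

Lemma contragredientE u y x : contragredient u y x = - y (rho u x).
Proof.
rewrite /contragredient linfun2E ?opp_lfunE ?comp_lfunE //.
  move=> v a u1 u2; apply/lfunP => w.
  by rewrite !(add_lfunE, scale_lfunE, opp_lfunE, comp_lfunE, linearP).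
move=> v a u1 u2; apply/lfunP => w.
rewrite !(add_lfunE, scale_lfunE, opp_lfunE, comp_lfunE) /=.
by rewrite opprD scalerN.
Qed.

Lemma ft_form_lker0 : lker B == 0%VS.
Proof.
apply/lker0P => u v Buv; apply/eqP; rewrite -subr_eq0; apply/eqP.
by apply: ft_form_nondegenerate => w; rewrite linearB /= Buv subrr zero_lfunE.
Qed.

Lemma ft_form_limg : limg B = fullv.
Proof.
apply/eqP; rewrite eqEdim subvf /= (limg_dim_eq _) ?(eqP ft_form_lker0) ?capv0 //.
by rewrite !dimvf /= /dim /= muln1.
Qed.

(* For x in V and y in V', [x, y] is the element of g representing the linear
   form u |-> y (rho u x) with respect to B: the bracket is
   B^-1 (u |-> y (rho u x)). *)
Definition gamma_form (x : V) (y : V') : 'Hom(g, F^o) :=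
  linfun (fun u : g => y (rho u x)).

Definition gamma_pair : 'Hom(V, 'Hom(V', g)) :=
  linfun2 (fun x y => (B^-1)%VF (gamma_form x y)).

Lemma gamma_formE x y u : gamma_form x y u = y (rho u x).
Proof.
have lin : linear (fun u : g => y (rho u x) : F^o).
  by move=> a u1 u2; rewrite linearP add_lfunE scale_lfunE linearP.
pose h : {linear g -> F^o} :=
  HB.pack (fun u : g => y (rho u x) : F^o)
          (GRing.isLinear.Build _ _ _ _ _ lin).
exact: (lfunE h).
Qed.

Lemma gamma_pairP x y u : B (gamma_pair x y) u = y (rho u x).
Proof.
rewrite /gamma_pair linfun2E.
- by rewrite limg_lfunVK ?gamma_formE // ft_form_limg memvf.
- move=> z a x1 x2; rewrite -linearP; congr (_ _); apply/lfunP => w.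
  by rewrite !(add_lfunE, scale_lfunE, gamma_formE, linearP).
- move=> z a y1 y2; rewrite -linearP; congr (_ _); apply/lfunP => w.
  by rewrite !(add_lfunE, scale_lfunE, gamma_formE).
Qed.

Lemma ft_repE u v x : rho (lie u v) x = rho u (rho v x) - rho v (rho u x).
Proof. by rewrite ft_repP add_lfunE opp_lfunE !comp_lfunE. Qed.

Lemma gamma_jacobi00n u v y : contragredient (lie u v) y =
  contragredient u (contragredient v y) - contragredient v (contragredient u y).
Proof.
apply/lfunP => x; rewrite add_lfunE opp_lfunE !contragredientE ft_repE.
by rewrite linearB /= !opprK opprB.
Qed.

Lemma gamma_jacobi0pn u x y : lie u (gamma_pair x y) =
  gamma_pair (rho u x) y + gamma_pair x (contragredient u y).
Proof.
apply: (lker0P ft_form_lker0); apply/lfunP => w.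
rewrite linearD add_lfunE /= !gamma_pairP contragredientE.
rewrite lieC linearN opp_lfunE /= ft_form_invariant gamma_pairP ft_repE.
by rewrite linearB /= opprB.
Qed.

Definition Gamma : local_lie_algebra F :=
  LocalLieAlgebra ft_repE gamma_jacobi00n gamma_jacobi0pn.

Definition derived_orbit (X : V) : set V :=
  [set rho U X | U in [set U | U \in lie_derived g]]%classic.

(* H0 is meant to be a central element acting by 2 on V (hence by -2 on V'). *)
Definition associated_to_sl2_triple (H0 : g) :=
  exists (X : V) (Y : V'), @sl2_triple F Gamma Y H0 X.
End Gamma.

(* Main.v *)
From HB Require Import structures.
Require Import Defs.
From mathcomp Require Import all_boot all_order all_algebra.
From mathcomp Require Import classical_sets reals complex.

(** The center and the derived algebra are B-orthogonal, because
    [B(z, [u, v]) = B([z, u], v) = 0] for central [z].  Since g is the sum of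
    [F H0] and its derived algebra g', two consequences follow: [B(H0, H0)] is
    nonzero by non-degeneracy ([form_center_neq0]), and an element of g is
    determined by its B-products with H0 and with g'.

    Consider the equation [- [X, Y] = H0].  As [B([X, Y], U) = Y(rho(U) X)] and
    [rho(H0) = 2 Id], pairing it with g' and with H0 turns it into
    [Y = 0 on g'.X] and [2 Y(X) = - B(H0, H0)] ([sl2_triple_iff]); the other
    two relations of an sl2-triple hold for all X and Y.  So X completes to a
    triple exactly when some linear form kills the subspace g'.X and takes a
    prescribed nonzero value at X, that is, when X is not in g'.X
    ([separating_form] provides the form). *)

Set Implicit Arguments.
Unset Strict Implicit.
Unset Printing Implicit Defensive.

Import GRing.Theory Num.Theory.
Local Open Scope ring_scope.

(** The form is a coordinate of the component of [x] along a complement of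
    [W], rescaled. *)
Lemma separating_form (F : fieldType) (V : vectType F) (W : {vspace V})
    (x : V) (c : F) :
  x \notin W ->
  exists Y : 'Hom(V, F^o), (forall w, w \in W -> Y w = 0) /\ Y x = c.
Proof.
move=> xW; pose q : 'End(V) := (\1 - projv W)%VF.
have qE v : q v = v - projv W v.
  by rewrite add_lfunE opp_lfunE id_lfunE.
have qx0 : q x != 0.
  apply: contraNneq xW => /eqP; rewrite qE subr_eq0 => /eqP ->.
  exact: memv_proj.
have [i ci0] : exists i, coord (vbasis fullv) i (q x) != 0.
  apply/existsP; apply: contraNT qx0; rewrite negb_exists => /forallP c0.
  rewrite (coord_vbasis (memvf (q x))) big1 // => i _.
  by move: (c0 i); rewrite negbK => /eqP ->; rewrite scale0r.
pose f : 'Hom(V, F^o) := linfun (coord (vbasis fullv) i : V -> F^o).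
have fE v : f v = coord (vbasis fullv) i v by rewrite lfunE.
exists ((c / coord (vbasis fullv) i (q x)) *: (f \o q)%VF); split=> [w wW|].
  by rewrite scale_lfunE comp_lfunE (qE w) projv_id // subrr linear0 scaler0.
by rewrite scale_lfunE comp_lfunE fE /GRing.scale /= divfK.
Qed.

Section Triples.
Variables (F : fieldType) (T : fundamental_triplet F).
Local Notation g := (ft_lie T).
Local Notation V := (ft_space T).
Local Notation B := (ft_form T).
Local Notation rho := (ft_rep T).

Lemma mem_derived_orbit (X v : V) :
  derived_orbit X v <->
  v \in (linfun (fun u : g => rho u X) @: lie_derived g)%VS.
Proof.
have lin : linear (fun u : g => rho u X).
  by move=> a u1 u2; rewrite linearP add_lfunE scale_lfunE.
pose h : {linear g -> V} :=
  HB.pack (fun u : g => rho u X) (GRing.isLinear.Build _ _ _ _ _ lin).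
have hE u : linfun (fun u : g => rho u X) u = rho u X by exact: (lfunE h).
split=> [[u uD <-]|/memv_imgP[u uD ->]]; first by rewrite -hE memv_img.
by exists u; rewrite ?hE.
Qed.

Lemma form_center_derived z u :
  z \in lie_center g -> u \in lie_derived g -> B z u = 0.
Proof.
move=> /lie_centerP zZ uD; apply/eqP; rewrite -[_ == 0]memv_ker.
apply: subvP uD; apply/lie_derivedP => x y.
by rewrite memv_ker -ft_form_invariant zZ linear0 zero_lfunE.
Qed.

Hypothesis g_reductive : reductive g.
Variable H0 : g.
Hypothesis center_H0 : lie_center g = <[H0]>%VS.

Lemma H0_central : H0 \in lie_center g.
Proof. by rewrite center_H0 memv_line. Qed.

Lemma center_derived_split u :
  exists a d, d \in lie_derived g /\ u = a *: H0 + d.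
Proof.
have := memvf u; rewrite -(reductive_decomposition g_reductive).1 center_H0.
by case/memv_addP=> _ /vlineP[a ->] [d dD ->]; exists a, d.
Qed.

Lemma form_ext u v : B u H0 = B v H0 ->
  (forall d, d \in lie_derived g -> B u d = B v d) -> u = v.
Proof.
move=> eqH eqD; apply: (lker0P (ft_form_lker0 T)); apply/lfunP => w.
have [a [d [dD ->]]] := center_derived_split w.
by rewrite !linearP /= eqH eqD.
Qed.

(** Otherwise H0, already orthogonal to the derived algebra, would lie in the
    radical of B. *)
Lemma form_center_neq0 : H0 != 0 -> B H0 H0 != 0.
Proof.
apply: contra_neq => BH0; apply: form_ext => [|d dD].
  by rewrite BH0 linear0 zero_lfunE.
by rewrite form_center_derived ?H0_central // linear0 zero_lfunE.
Qed.

Hypothesis rho_H0 : rho H0 = 2%:R *: \1%VF.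

Lemma rho_H0E X : rho H0 X = 2%:R *: X.
Proof. by rewrite rho_H0 scale_lfunE id_lfunE. Qed.

(** The relation [- [X, Y] = H0] is tested against g' and H0 separately; the
    weight relations are automatic. *)
Lemma sl2_triple_iff (X : V) (Y : 'Hom(V, F^o)) :
  @sl2_triple F (Gamma T) Y H0 X <->
  (forall v, derived_orbit X v -> Y v = 0) /\ 2%:R * Y X = - B H0 H0.
Proof.
have YH0 : B (gamma_pair T X Y) H0 = 2%:R * Y X.
  by rewrite gamma_pairP rho_H0E linearZ.
split=> [[_ _ /= XY]|[YD YX]].
  have BXY u : B (gamma_pair T X Y) u = - B H0 u.
    by rewrite -XY linearN opp_lfunE opprK.
  split=> [_ [u uD <-]|]; last by rewrite -YH0 BXY.
  by rewrite -gamma_pairP BXY form_center_derived ?H0_central ?oppr0.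
split=> /=; first exact: rho_H0E.
  apply/lfunP => v.
  by rewrite contragredientE opp_lfunE scale_lfunE rho_H0E linearZ.
apply: form_ext => [|d dD]; rewrite linearN opp_lfunE.
  by rewrite /= YH0 YX opprK.
rewrite gamma_pairP YD; last by exists d.
by rewrite form_center_derived ?H0_central ?oppr0.
Qed.

Lemma sl2_triple_completion (X : V) : H0 != 0 -> 2%:R != 0 :> F ->
  ~ derived_orbit X X <->
  exists Y : 'Hom(V, F^o), @sl2_triple F (Gamma T) Y H0 X.
Proof.
move=> nz_H0 nz2; split=> [XnD|[Y /sl2_triple_iff[YD YX]] /YD YX0].
  have /negP XnW := contra_not (mem_derived_orbit X X).2 XnD.
  have [Y [YW YX]] := separating_form (- B H0 H0 / 2%:R : F) XnW.
  exists Y; apply/sl2_triple_iff; split=> [v /mem_derived_orbit/YW //|].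
  by rewrite YX mulrC divfK.
have := form_center_neq0 nz_H0.
by rewrite -oppr_eq0 -YX YX0 mulr0 eqxx.
Qed.

End Triples.

Unset Implicit Arguments.

Theorem theorem4p1p2 (R : realType) (T : fundamental_triplet R[i])
    (g_reductive : reductive (ft_lie T))
    (dim_center : \dim (lie_center (ft_lie T)) = 1%N)
    (rho_center : (ft_rep T @: lie_center (ft_lie T))%VS = <[\1%VF]>%VS)
    (H0 : ft_lie T) (H0_center : H0 \in lie_center (ft_lie T))
    (H0_neq0 : H0 != 0) (rho_H0 : ft_rep T H0 = 2%:R *: \1%VF) :
  (associated_to_sl2_triple H0 <->
     exists X : ft_space T, ~ derived_orbit X X) /\
  [set X : ft_space T | ~ derived_orbit X X]%classic =
  [set X : ft_space T | exists Y : 'Hom(ft_space T, R[i]^o),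
     @sl2_triple R[i] (Gamma T) Y H0 X]%classic.
Proof.
have center_H0 : lie_center (ft_lie T) = <[H0]>%VS.
  apply/esym/eqP.
  by rewrite eqEdim -memvE H0_center dim_center dim_vline H0_neq0.
have nz2 : 2%:R != 0 :> R[i] by rewrite pnatr_eq0.
have completion X :=
  sl2_triple_completion g_reductive center_H0 rho_H0 X H0_neq0 nz2.
split; last by apply/seteqP; split=> X /= /completion.
by split=> [[X XY]|[X /completion XY]]; exists X => //; apply/completion.
Qed.
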